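(* Let $\mathcal{I}$ be a nontrivial admissible ideal of subsets of $\mathbb{N}$. For every sequence $(s)=\{s_n\}_{n\in\mathbb{N}}\in\Sigma_{\mathcal{I}}$, the family $\mathcal{T}^{\mathcal{I}}_{(s)}=\{A\in\mathcal{L}: A\subseteq \Phi^{\mathcal{I}}_{(s)}(A)\}$ is a topology on $\mathbb{R}$.
   Context: $\mathcal{L}$ is the $\sigma$-algebra of Lebesgue measurable subsets of $\mathbb{R}$ and $\lambda$ is Lebesgue measure on $\mathbb{R}$. An ideal $\mathcal{I}$ of subsets of $\mathbb{N}$ is a nonempty family $\mathcal{I}\subset 2^{\mathbb{N}}$ closed under finite unions and under taking subsets; it is nontrivial if $\mathcal{I}\neq\{\emptyset\}$ and $\mathcal{I}\neq 2^{\mathbb{N}}$, and admissible if it contains all singletons (hence all finite subsets of $\mathbb{N}$). $\mathcal{F}(\mathcal{I})=\{M\subset\mathbb{N}:\mathbb{N}\setminus M\in\mathcal{I}\}$ is the associated filter. A real sequence $\{x_n\}$ is $\mathcal{I}$-convergent to $x_0$, written $\mathcal{I}\text{-}\lim_n x_n=x_0$, if $\{k\in\mathbb{N}:|x_k-x_0|\ge\epsilon\}\in\mathcal{I}$ for every $\epsilon>0$. A real sequence $\{x_n\}$ is $\mathcal{I}$-monotonic increasing if there is a set $\{k_1<k_2<\cdots\}\in\mathcal{F}(\mathcal{I})$ such that $x_{k_i}\le x_{k_{i+1}}$ for every $i\in\mathbb{N}$. $\Sigma_{\mathcal{I}}$ denotes the family of all unbounded, $\mathcal{I}$-monotonic increasing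 sequences of positive reals. For $(s)=\{s_n\}\in\Sigma_{\mathcal{I}}$ and $A\in\mathcal{L}$, a point $p\in\mathbb{R}$ is an $\mathcal{I}_{(s)}$-density point of $A$ if $\mathcal{I}\text{-}\lim_n \frac{\lambda\left(A\cap\left[p-\frac1{s_n},p+\frac1{s_n}\right]\right)}{2/s_n}=1$. $\Phi^{\mathcal{I}}_{(s)}(A)$ is the set of all $\mathcal{I}_{(s)}$-density points of $A$. *)

(* Defs.v *)
From HB Require Import structures.
From mathcomp Require Import all_boot all_order all_algebra.
From mathcomp Require Import all_classical all_reals all_analysis.

Set Implicit Arguments.
Unset Strict Implicit.
Unset Printing Implicit Defensive.
Import Order.TTheory GRing.Theory Num.Theory.
Import numFieldNormedType.Exports.

Local Open Scope classical_set_scope.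
Local Open Scope ring_scope.

Definition is_ideal (I : set (set nat)) : Prop :=
  [/\ I !=set0,
      forall A B, I A -> I B -> I (A `|` B) &
      forall A B, A `<=` B -> I B -> I A].

Definition nontrivial_ideal (I : set (set nat)) : Prop :=
  I <> [set set0] /\ I <> setT.

Definition admissible_ideal (I : set (set nat)) : Prop :=
  forall n, I [set n].

Definition ideal_filter (I : set (set nat)) : set (set nat) :=
  [set M | I (~` M)].

Definition ideal_cvg (R : realType) (I : set (set nat)) (x : nat -> R)
    (x0 : R) : Prop :=
  forall e : R, 0 < e -> I [set k | e <= `|x k - x0|].

Definition ideal_increasing (R : realType) (I : set (set nat))
    (x : nat -> R) : Prop :=
  exists k : nat -> nat,
    [/\ forall i, (k i < k i.+1)%N,
        ideal_filter I (range k) &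
        forall i, x (k i) <= x (k i.+1)].

(* Unboundedness is that of the whole sequence, not of its restriction to the
   filter set witnessing monotonicity. *)
Definition Sigma_seq (R : realType) (I : set (set nat)) : set (nat -> R) :=
  [set s : nat -> R | [/\ forall n, 0 < s n, ~ bounded_set (range s) & ideal_increasing I s]].

(* The Lebesgue (not just Borel) measurable sets: those that are Caratheodory
   measurable for the outer measure generated by interval length, which is the
   domain of completed_lebesgue_measure. *)
Definition lebesgue_measurable (R : realType) : set (set R) :=
  ((wlength (@idfun R))^*)%mu.-cara.-measurable.

(* The window has finite measure, so that fine loses no information. *)
Definition density_quotient (R : realType) (s : nat -> R) (A : set R) (p : R)
    (n : nat) : R :=
  fine (completed_lebesgue_measure
          (A `&` `[p - 1 / s n, p + 1 / s n]%classic)) / (2 / s n).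

Definition density_points (R : realType) (I : set (set nat)) (s : nat -> R)
    (A : set R) : set R :=
  [set p | ideal_cvg I (density_quotient s A p) 1].

Definition density_family (R : realType) (I : set (set nat)) (s : nat -> R) :
    set (set R) :=
  [set A | lebesgue_measurable A /\ A `<=` density_points I s A].

Definition is_topology (X : Type) (T : set (set X)) : Prop :=
  [/\ T set0, T setT,
      forall A B, T A -> T B -> T (A `&` B) &
      forall F : set (set X), F `<=` T -> T (\bigcup_(A in F) A)].

(* Main.v *)
Require Import Defs.
From mathcomp Require Import all_boot all_order all_algebra.
From mathcomp Require Import all_classical all_reals all_analysis.

Set Implicit Arguments.
Unset Strict Implicit.
Unset Printing Implicit Defensive.
Import Order.TTheory GRing.Theory Num.Theory.
Import numFieldNormedType.Exports.

Local Open Scope classical_set_scope.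
Local Open Scope ring_scope.

(** For measurable A the relative measures of A and of its complement in a
    window add up to 1, so p is a density point of A exactly when the relative
    measure of the complement of A at p tends to 0 along the ideal, i.e. p is
    a dispersion point of the complement ([density_pointsC]).  Dispersion
    points behave like an ideal of sets: they pass to subsets and to unions of
    two sets, and every null set disperses everywhere.  This gives finite
    intersections at once, and also the inclusion of a union in its set of
    density points.

    What remains is that an arbitrary union U of members of the family is
    Lebesgue measurable.  By sigma-finiteness U has a measurable core B, a
    measurable subset which contains every measurable subset of U up to a null
    set ([measurable_core]).  Each member A of the family satisfies
    lambda (A \ B) = 0, so the density points of A are density points of B,
    and U lies between B and the density points of B.  But almost every point
    outside B is an ordinary Lebesgue density point of the complement of B,
    and there the complement does not disperse: on a set of the filter s is at
    least some c > 0, so the windows have bounded length, and the part of the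
    complement inside them is a fixed positive fraction
    ([density_quotient_bounded_below]).  So U \ B is null and U is measurable
    by completeness. *)

(** * Measurable cores *)

(** The core is built by exhaustion: on each piece [F n] of finite measure,
    take measurable subsets of [U] whose measures approach the supremum. Their
    union [B] attains all these suprema at once, so adding any [A] to it cannot
    increase the measure on any piece. *)
Lemma measurable_core d (T : measurableType d) (R : realType)
    (mu : {sigma_finite_measure set T -> \bar R}) (U : set T) :
  exists B, [/\ measurable B, B `<=` U &
    forall A, measurable A -> A `<=` U -> mu (A `\` B) = 0%E].
Proof.
have /sigma_finiteP[F [FT _ mF]] := sigma_finiteT mu.
pose S n := [set mu (A `&` F n) | A in [set A | measurable A /\ A `<=` U]].
have S_le n : (ereal_sup (S n) <= mu (F n))%E.
  apply: ge_ereal_sup => _ [A [mA _] <-]; apply: le_measure; rewrite ?inE//.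
  - by apply: measurableI => //; exact: (mF n).1.
  - exact: (mF n).1.
have S_ge0 n : (0 <= ereal_sup (S n))%E.
  by apply: ereal_sup_ubound; exists set0; rewrite ?set0I ?measure0//; split.
have S_fin n : ereal_sup (S n) \is a fin_num.
  by rewrite ge0_fin_numE// (le_lt_trans (S_le n))//; exact: (mF n).2.
have /choice[G GP] : forall nm : nat * nat, exists A, [/\ measurable A, A `<=` U &
    (ereal_sup (S nm.1) - nm.2.+1%:R^-1%:E < mu (A `&` F nm.1))%E].
  move=> [n m]; have e0 : 0 < m.+1%:R^-1 :> R by rewrite invr_gt0.
  by have [_ [A [mA AU] <-] lt] := ub_ereal_sup_adherent e0 (S_fin n); exists A.
have mB : measurable (\bigcup_n \bigcup_m G (n, m)).
  by apply: bigcupT_measurable => n; apply: bigcupT_measurable => m; case: (GP (n, m)).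
exists (\bigcup_n \bigcup_m G (n, m)); set B := \bigcup_n _ in mB *.
have BU : B `<=` U by move=> x [n _ [m _]]; have [_ + _] := GP (n, m); exact.
split=> // A mA AU.
have null n : mu ((A `\` B) `&` F n) = 0%E.
  have mFn := (mF n).1.
  have mABF : measurable ((A `\` B) `&` F n).
    by apply: measurableI => //; exact: measurableD.
  have mBF : measurable (B `&` F n) by exact: measurableI.
  have fBF : mu (B `&` F n) \is a fin_num.
    rewrite ge0_fin_numE// (le_lt_trans _ (mF n).2)//.
    by apply: le_measure; rewrite ?inE.
  apply/eqP; rewrite eq_le measure_ge0 andbT.
  apply/lee_addgt0Pr => e e0; rewrite add0e.
  have [m _ /(_ m (leqnn m))/= me] := near_infty_natSinv_lt (PosNum e0).
  have [mG GU supG] := GP (n, m).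
  have : (mu ((A `\` B) `&` F n) + mu (B `&` F n) <= ereal_sup (S n))%E.
    rewrite -measureU//; last first.
      by rewrite -subset0 => x [[[_ nB] _] [/nB]].
    rewrite -setIUl; apply: ereal_sup_ubound.
    exists (A `\` B `|` B) => //; split; last by move=> x [[/AU]|/BU].
    by apply: measurableU => //; exact: measurableD.
  rewrite -leeBrDr// => /le_trans; apply.
  rewrite leeBlDr//.
  have : (ereal_sup (S n) <= mu (B `&` F n) + m.+1%:R^-1%:E)%E.
    rewrite -leeBlDr//; apply: (le_trans (ltW supG)); apply: le_measure; rewrite ?inE//.
      exact: measurableI.
    by apply: setSI => x Gx; exists n => //; exists m.
  by move=> /le_trans; apply; rewrite addeC leeD2r// lee_fin ltW.
have -> : A `\` B = \bigcup_n ((A `\` B) `&` F n).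
  by rewrite -setI_bigcupr -FT setIT.
apply: measure_negligible.
  by apply: bigcupT_measurable => n; apply: measurableI; [exact: measurableD|exact: (mF n).1].
apply: negligible_bigcup => n; apply/negligibleP; last exact: null.
by apply: measurableI; [exact: measurableD|exact: (mF n).1].
Qed.

(** * Relative measure in a window *)

Section windows.
Context {R : realType}.
Implicit Types (A B C : set R) (s : nat -> R) (p : R) (n : nat).
Local Notation cmu := (@completed_lebesgue_measure R).

Lemma le_completed_lebesgue_measure A B : A `<=` B -> (cmu A <= cmu B)%E.
Proof. exact: (le_outer_measure ((wlength (@idfun R))^*)%mu). Qed.

Lemma completed_lebesgue_measure_ge0 A : (0 <= cmu A)%E.
Proof. exact: (outer_measure_ge0 ((wlength (@idfun R))^*)%mu). Qed.

Lemma completed_lebesgue_measureU_le A B : (cmu (A `|` B) <= cmu A + cmu B)%E.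
Proof. exact: (outer_measureU2 ((wlength (@idfun R))^*)%mu). Qed.

Lemma lebesgue_measurable_borel (A : set (measurableTypeR R)) :
  measurable A -> lebesgue_measurable A.
Proof. exact: sub_caratheodory. Qed.

Lemma lebesgue_measurable_null A :
  (@lebesgue_measure R).-negligible A -> lebesgue_measurable A.
Proof.
move=> [B [mB B0 AB]]; apply: negligible_sub_caratheodory.
by exists B; split=> //; exact: lebesgue_measurable_borel.
Qed.

Lemma completed_measure_window p r : 0 < r ->
  cmu `[p - r, p + r] = (r + r)%:E.
Proof.
move=> r0; change (lebesgue_measure [set` `[p - r, p + r]] = (r + r)%:E).
rewrite lebesgue_measure_itv/= lte_fin ler_ltD ?gtrN// -EFinB; congr EFin.
by rewrite opprB addrC addrA subrK.
Qed.

Lemma window_fin_num A p r : 0 < r -> cmu (A `&` `[p - r, p + r]) \is a fin_num.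
Proof.
move=> r0; rewrite ge0_fin_numE ?completed_lebesgue_measure_ge0//.
rewrite (@le_lt_trans _ _ (r + r)%:E) ?ltry// -(completed_measure_window p r0).
by apply: le_completed_lebesgue_measure; exact: subIsetr.
Qed.

(** Inherited from the outer measure underlying the completed measure; the
    windows have finite measure, so taking real values is harmless. *)
Lemma density_quotient_subadd s A B C p n : 0 < s n -> C `<=` A `|` B ->
  density_quotient s C p n <= density_quotient s A p n + density_quotient s B p n.
Proof.
move=> s0 CAB; have r0 : 0 < 1 / s n by rewrite divr_gt0.
rewrite /density_quotient -mulrDl ler_pM2r ?invr_gt0 ?divr_gt0//.
rewrite -fineD ?window_fin_num// fine_le ?fin_numD ?window_fin_num//.
apply: le_trans (completed_lebesgue_measureU_le _ _).
by rewrite -setIUl; apply: le_completed_lebesgue_measure; exact: setSI.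
Qed.

Lemma density_quotientS s A B p n : 0 < s n -> A `<=` B ->
  density_quotient s A p n <= density_quotient s B p n.
Proof.
move=> s0 AB; have r0 : 0 < 1 / s n by rewrite divr_gt0.
rewrite /density_quotient ler_pM2r ?invr_gt0 ?divr_gt0//.
rewrite fine_le ?window_fin_num//.
by apply: le_completed_lebesgue_measure; exact: setSI.
Qed.

Lemma density_quotient_null s A p n : cmu A = 0%E -> density_quotient s A p n = 0.
Proof.
move=> A0; rewrite /density_quotient (_ : cmu _ = 0%E) ?mul0r//.
apply/eqP; rewrite eq_le completed_lebesgue_measure_ge0 andbT -A0.
by apply: le_completed_lebesgue_measure; exact: subIsetl.
Qed.

Lemma density_quotientC s A p n : 0 < s n -> lebesgue_measurable A ->
  density_quotient s A p n + density_quotient s (~` A) p n = 1.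
Proof.
move=> s0 mA; have r0 : 0 < 1 / s n by rewrite divr_gt0.
rewrite /density_quotient -mulrDl -fineD ?window_fin_num//.
rewrite ![_ `&` `[_, _]%classic]setIC.
pose W := `[p - 1 / s n, p + 1 / s n]%classic.
rewrite -/W; have <- : cmu W = (cmu (W `&` A) + cmu (W `&` ~` A))%E by exact: mA.
rewrite completed_measure_window//= -mulrDl divff// gt_eqF// divr_gt0//.
Qed.

Lemma density_quotient_ge0 s A p n : 0 < s n -> 0 <= density_quotient s A p n.
Proof.
move=> s0; rewrite -(@density_quotient_null s set0 p n); last first.
  exact: (outer_measure0 ((wlength (@idfun R))^*)%mu).
exact: density_quotientS.
Qed.

End windows.

(** * Density and dispersion along the ideal *)

Section ideal_density.
Context {R : realType} (I : set (set nat)) (s : nat -> R).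
Implicit Types (A B C : set R).
Hypotheses (hI : is_ideal I) (hnontriv : nontrivial_ideal I).
Hypothesis s_gt0 : forall n, 0 < s n.
Local Notation cmu := (@completed_lebesgue_measure R).

(** Passing to the complement turns the two-sided limit 1 into a limit 0 of
    nonnegative numbers, for which only upper bounds matter. *)
Lemma density_pointsC A p : lebesgue_measurable A ->
  density_points I s A p <->
  ideal_cvg I (density_quotient s (~` A) p) 0.
Proof.
move=> mA; rewrite /density_points /ideal_cvg /=.
suff E n : `|density_quotient s A p n - 1| =
    `|density_quotient s (~` A) p n - 0|.
  have SE e : [set n | e <= `|density_quotient s A p n - 1|] =
      [set n | e <= `|density_quotient s (~` A) p n - 0|].
    by apply/seteqP; split=> n /=; rewrite E.
  by split=> + e e0 => /(_ e e0); rewrite SE.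
by rewrite -(density_quotientC p (s_gt0 n) mA) opprD addrA subrr add0r normrN subr0.
Qed.

Lemma ideal_cvg0_quotient A p :
  ideal_cvg I (density_quotient s A p) 0 <->
  forall e, 0 < e -> I [set n | e <= density_quotient s A p n].
Proof.
suff E n : `|density_quotient s A p n - 0| = density_quotient s A p n.
  have SE e : [set n | e <= `|density_quotient s A p n - 0|] =
      [set n | e <= density_quotient s A p n].
    by apply/seteqP; split=> n /=; rewrite E.
  by split=> + e e0 => /(_ e e0); rewrite SE.
by rewrite subr0 ger0_norm// density_quotient_ge0.
Qed.

Lemma dispersion_subadd A B C p : C `<=` A `|` B ->
  ideal_cvg I (density_quotient s A p) 0 ->
  ideal_cvg I (density_quotient s B p) 0 ->
  ideal_cvg I (density_quotient s C p) 0.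
Proof.
move=> CAB /ideal_cvg0_quotient IA /ideal_cvg0_quotient IB.
apply/ideal_cvg0_quotient => e e0; have [_ IU IS] := hI.
have e20 : 0 < e / 2 by rewrite divr_gt0.
apply: IS (IU _ _ (IA _ e20) (IB _ e20)) => n /= eC.
have := le_trans eC (density_quotient_subadd p (s_gt0 n) CAB).
case: (lerP (e / 2) (density_quotient s A p n)) => [|A2 AB]; first by left.
right; rewrite leNgt; apply/negP => B2.
by have := le_lt_trans AB (ltrD A2 B2); rewrite -splitr ltxx.
Qed.

Lemma dispersionS A B p : A `<=` B ->
  ideal_cvg I (density_quotient s B p) 0 ->
  ideal_cvg I (density_quotient s A p) 0.
Proof. by move=> AB IB; apply: (dispersion_subadd (A := B) (B := B)) => // x /AB; left. Qed.

Lemma dispersion_null A p : cmu A = 0%E ->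
  ideal_cvg I (density_quotient s A p) 0.
Proof.
move=> A0; apply/ideal_cvg0_quotient => e e0; have [[X IX] _ IS] := hI.
by apply: IS IX => n /=; rewrite density_quotient_null// leNgt e0.
Qed.

(** Otherwise a set of the filter would belong to the ideal, and the ideal
    would contain every set of indices. *)
Lemma dispersion_not_bounded_below A p e (M : set nat) : ideal_filter I M ->
  0 < e -> (forall n, M n -> e <= density_quotient s A p n) ->
  ~ ideal_cvg I (density_quotient s A p) 0.
Proof.
move=> IM e0 Me /ideal_cvg0_quotient/(_ e e0) Ie; have [_ IU IS] := hI.
apply: hnontriv.2; apply/seteqP; split=> // X _.
apply: IS (IU _ _ IM Ie) => n _; have [/Me|] := pselect (M n); first by right.
by left.
Qed.

End ideal_density.

(** * Comparison with Lebesgue density *)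

(** The bound [r] is half of the measure of the ball: near a density point of
    [X] the relative measure of [X] exceeds 1/2. *)
Lemma lebesgue_density_half (R : realType) (X : set (measurableTypeR R)) (p : R) :
  X p ->
  (lebesgue_measure (X `&` ball p r) * (lebesgue_measure (ball p r))^-1)%E
     @[r --> 0^'+] --> (\1_X p)%:E ->
  exists2 d : R, 0 < d & forall r, 0 < r -> r < d ->
    (r%:E <= lebesgue_measure (X `&` ball p r))%E.
Proof.
move=> Xp; rewrite indicE mem_set// => cvX.
have : nbhs (1%:E : \bar R) [set y | ((2^-1)%:E < y)%E].
  apply: open_nbhs_nbhs; split; first exact: open_ereal_gt_ereal.
  by rewrite /= lte_fin invf_lt1// ltr1n.
move=> /cvX[d /= d0 dX]; exists d => // r r0 rd.
have {dX} : ((2^-1)%:E < lebesgue_measure (X `&` ball p r) * (lebesgue_measure (ball p r))^-1)%E.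
  by apply: dX => //; rewrite /ball/= sub0r normrN gtr0_norm.
have r20 : 0 < r *+ 2 by rewrite mulrn_wgt0.
rewrite lebesgue_measure_ball ?(ltW r0)// inver gt_eqF//.
move=> /ltW; rewrite lee_pdivlMr// -EFinM.
by rewrite -[r *+ 2]mulr_natl mulKf.
Qed.

Section union.
Context {R : realType} (I : set (set nat)) (s : nat -> R).
Implicit Types (A B C : set R).
Hypotheses (hI : is_ideal I) (hnontriv : nontrivial_ideal I).
Hypothesis s_gt0 : forall n, 0 < s n.
Local Notation cmu := (@completed_lebesgue_measure R).

(** Either the window has radius less than [d] and the hypothesis applies to it
    directly, or it contains the ball of radius [d / 2], which holds a
    definite amount of [C], while its length is at most [2 / c]. *)
Lemma density_quotient_bounded_below C p c d n : 0 < c -> c <= s n -> 0 < d ->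
  (forall r, 0 < r -> r < d -> (r%:E <= cmu (C `&` ball p r))%E) ->
  Order.min 2^-1 (d * c / 4) <= density_quotient s C p n.
Proof.
move=> c0 cs d0 Cd.
have r0 : 0 < 1 / s n by rewrite divr_gt0.
have le_q r : 0 < r -> r < d -> r <= 1 / s n -> r * s n / 2 <= density_quotient s C p n.
  move=> r1 rd rs; rewrite /density_quotient invf_div mulrA.
  rewrite ler_pM2r ?invr_gt0// ler_pM2r// -lee_fin fineK ?window_fin_num//.
  apply: le_trans (Cd _ r1 rd) (le_completed_lebesgue_measure _).
  apply: setIS; rewrite ball_itv; apply: subset_itv; rewrite bnd_simp.
    by rewrite lerD2l lerN2.
  by rewrite lerD2l.
have [sd|ds] := ltP (1 / s n) d.
  have := le_q _ r0 sd (lexx _); rewrite divfK ?gt_eqF// div1r.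
  by apply: le_trans; rewrite ge_min lexx.
have d20 : 0 < d / 2 by rewrite divr_gt0.
have d2d : d / 2 < d by rewrite ltr_pdivrMr// ltr_pMr// ltr1n.
have := le_q _ d20 d2d (le_trans (ltW d2d) ds); apply: le_trans.
rewrite ge_min; apply/orP; right.
rewrite -(mulrA _ (s n)) -(mulrA d) -(mulrA d) ler_pM2l// mulrCA.
by rewrite -invfM -natrM ler_pM2r// invr_gt0.
Qed.

(** One half of the Lebesgue density theorem for windows along an ideal. Up to
    a null set the complement of [B] is a Borel set, whose ordinary density
    points cannot be dispersion points. *)
Lemma density_points_setD_negligible B (M : set nat) c :
  ideal_filter I M -> 0 < c -> (forall n, M n -> c <= s n) ->
  lebesgue_measurable B ->
  (@lebesgue_measure R).-negligible (density_points I s B `\` B).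
Proof.
move=> IM c0 Mc mB.
have : (measurable_realfun.completed_algebra_gen (@lebesgue_measure R)) (~` B).
  rewrite -g_sigma_completed_algebra_genE completed_caratheodory_measurable.
  exact: measurableC.
move=> [X mX [N negN XN]].
have [Z [mZ Z0 XZ]] := lebesgue_density mX.
apply: (@negligibleS _ _ _ _ (Z `|` N)); last first.
  by apply: negligibleU => //; exists Z; split.
move=> p [Bp nBp]; have : (X `|` N) p by rewrite XN.
move=> [Xp|]; last by right.
left; apply: XZ => /= dens.
have [d d0 dX] := lebesgue_density_half Xp dens.
have /(density_pointsC I s_gt0 p mB) := Bp.
apply: (@dispersion_not_bounded_below R I s hI hnontriv s_gt0 (~` B) p
  (Order.min 2^-1 (d * c / 4)) M) => //.
  by rewrite lt_min invr_gt0 ltr0n/= divr_gt0// mulr_gt0.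
move=> n Mn; apply: density_quotient_bounded_below (Mc n Mn) d0 _ => // r r0 rd.
apply: le_trans (dX r r0 rd) _; apply: le_completed_lebesgue_measure.
by apply: setSI; rewrite -XN; exact: subsetUl.
Qed.

(** The union is squeezed between its measurable core [B] and the density
    points of [B], which differ by a null set. *)
Lemma lebesgue_measurable_bigcup (F : set (set R)) (M : set nat) c :
  ideal_filter I M -> 0 < c -> (forall n, M n -> c <= s n) ->
  F `<=` density_family I s -> lebesgue_measurable (\bigcup_(A in F) A).
Proof.
move=> IM c0 Mc FT; set U := \bigcup_(A in F) A.
have [B [mB BU core]] := @measurable_core _ _ _ (@completed_lebesgue_measure R) U.
have UB : U `\` B `<=` density_points I s B `\` B.
  move=> p [[A FA Ap] nBp]; split=> //; have [mA AA] := FT A FA.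
  apply/(density_pointsC I s_gt0 p mB).
  have /(density_pointsC I s_gt0 p mA) := AA p Ap.
  have : cmu (A `\` B) = 0%E by apply: core => // x Ax; exists A.
  move=> /(dispersion_null hI s_gt0) AB0 disA.
  apply: dispersion_subadd disA (AB0 p) => // x nBx.
  by have [Ax|] := pselect (A x); [right|left].
have := density_points_setD_negligible IM c0 Mc mB.
move=> negB; have mUB : lebesgue_measurable (U `\` B).
  by apply: lebesgue_measurable_null; exact: (negligibleS (mu := @lebesgue_measure R) UB negB).
rewrite -(setDUK BU); exact: measurableU.
Qed.

End union.

Theorem theorem4p8 (R : realType) (I : set (set nat))
    (hI : is_ideal I) (hnontriv : nontrivial_ideal I)
    (hadm : admissible_ideal I) (s : nat -> R) (hs : Sigma_seq I s) :
  is_topology (density_family I s).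
Proof.
have [s_gt0 _ [k [_ Ik sk]]] := hs.
have m0 : lebesgue_measurable (@set0 R) by exact: measurable0.
have mT : lebesgue_measurable [set: R] by exact: measurableT.
split.
- by split=> // x.
- split=> // p _; apply/(density_pointsC I s_gt0 p mT); rewrite setCT.
  apply: dispersion_null => //; exact: measure0.
- move=> A B [mA AA] [mB BB].
  have mAB : lebesgue_measurable (A `&` B) by exact: measurableI.
  split=> // p [Ap Bp]; apply/(density_pointsC I s_gt0 p mAB).
  have /(density_pointsC I s_gt0 p mA) disA := AA p Ap.
  have /(density_pointsC I s_gt0 p mB) disB := BB p Bp.
  by apply: dispersion_subadd disA disB => //; rewrite setCI.
- move=> F FT.
  (* monotonicity along [k] bounds [s] below by its first value there *)
  have sk0 n : range k n -> s (k 0%N) <= s n.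
    move=> [i _ <-]; elim: i => // i IH; exact: le_trans IH (sk i).
  have mU := lebesgue_measurable_bigcup hI hnontriv s_gt0 Ik (s_gt0 _) sk0 FT.
  split=> // p [A FA Ap]; have [mA AA] := FT A FA.
  apply/(density_pointsC I s_gt0 p mU).
  have /(density_pointsC I s_gt0 p mA) := AA p Ap.
  by apply: dispersionS => //; apply: subsetC => x Ax; exists A.
Qed.
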